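(* Let $N\ge 1$, let $\nu_1,\dots,\nu_{N-1}\in\mathbb{R}$, let $A=\sum_{i=1}^{N-1}\nu_iE_{i,i+1}$, $J=\sum_{i=1}^N (N-i)E_{i,i}$, and $W(x)=e^{-x^2}e^{Ax}e^{A^{T}x}$, $x\in\mathbb{R}$. Let $(\widehat P_k)_{k\in\mathbb N}$ be the monic matrix orthogonal polynomials with respect to $W$, let $P_k(x)=e^{-A^2/4}\widehat P_k(x)$, and let $C_k,D_k$ be constant matrices such that for all $x\in\mathbb R$ and $k\in\mathbb N$ $$P_k(x)e^{Ax}=\oint_{\gamma}z^{-J}C_kz^{J}e^{-z^2+2zx}\frac{dz}{z^{k+1}},\qquad P_k(x)e^{Ax}=e^{x^2}\int_{\mathcal I}w^{J}D_kw^{-J}e^{w^2-2xw}w^k\,dw .$$ Then the Hermite-type Christoffel–Darboux kernel $K_n(x,y)$ associated with $W$ can be written as $$K_n(x,y)=e^{(x^2-y^2)/2}\int_{\mathcal I}dw\oint_{\gamma}dz\;M_n(z,w)\,e^{w^2-2xw-z^2+2zy},$$ where $$M_n(z,w)=z^{J}\left[\sum_{k=0}^{n-1}C_k^{T}z^{-J}\|P_k\|_{W}^{-2}w^{J}D_k\left(\frac wz\right)^k\right]\frac1z\,w^{-J}.$$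
   Context: $E_{i,j}$ is the $N\times N$ elementary matrix with $1$ at entry $(i,j)$ and $0$ elsewhere; $T$ denotes the transpose. The matrix-valued inner product is $\langle F,G\rangle_W=\int_{\mathbb{R}}F(x)W(x)G^{T}(x)\,dx$; monic matrix orthogonal polynomials satisfy $\widehat P_k(x)=x^kI_N+\cdots$ and $\langle\widehat P_k,\widehat P_m\rangle_W=0$ for $k\neq m$. $\|P_k\|_W^2:=\langle P_k,P_k\rangle_W$ (a positive definite matrix), $\|P_k\|_W^{-2}$ is its inverse and $\|P_k\|_W^{-1}$ the positive square root of that inverse. The Hermite-type Christoffel–Darboux kernel is $K_n(x,y):=\sum_{k=0}^{n-1}\Phi_k^{T}(y)\Phi_k(x)$ with $\Phi_k(x):=e^{-x^2/2}\|P_k\|_W^{-1}P_k(x)e^{Ax}$. For a matrix $M$, $z^{M}:=e^{M\log z}$ with branch cut of $\log$ on the negative real axis. The contour $\gamma$ comes from $-\infty$ below the negative real axis, goes counterclockwise around the origin, and returns to $-\infty$ above the negative real axis; $\mathcal I=L+i\mathbb R$ (oriented upwards), with $L>0$ such that $\gamma$ lies to the left of $\mathcal I$ and does not intersect it. (Matrices $C_k,D_k$ with the required property exist.) *)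

(* Defs.v *)
From HB Require Import structures.
From mathcomp Require Import all_boot all_order all_algebra.
From mathcomp Require Import all_classical all_reals all_analysis.
From mathcomp Require Import complex.

Set Implicit Arguments.
Unset Strict Implicit.
Unset Printing Implicit Defensive.
Import Order.TTheory GRing.Theory Num.Theory.
Import numFieldNormedType.Exports.
Local Open Scope classical_set_scope.
Local Open Scope ring_scope.
Local Open Scope complex_scope.

Local Notation mu := (@lebesgue_measure _).
Local Notation Re := (@complex.Re _).
Local Notation Im := (@complex.Im _).
Local Notation normc := ComplexField.Normc.normc.

(* Square matrices have size m.+1, so N >= 1 is N = m.+1; the 1-based index i
   of E_{i,j} is the ordinal of value i - 1. *)

Definition expm (K : numFieldType) (m : nat) (M : 'M[K]_m.+1) : 'M[K]_m.+1 :=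
  lim (series (fun k => (k`!%:R)^-1 *: M ^+ k) @ \oo).

Definition toC (R : realType) (m n : nat) (M : 'M[R]_(m, n)) : 'M[R[i]]_(m, n) :=
  map_mx (real_complex R) M.

Definition cexp (R : realType) (z : R[i]) : R[i] :=
  (expR (Re z))%:C * (cos (Im z) +i* sin (Im z)).

(* principal argument, with values in ]-pi, pi] for z != 0 *)
Definition carg (R : realType) (z : R[i]) : R :=
  if 0 <= Im z then acos (Re z / normc z) else - acos (Re z / normc z).

Definition clog (R : realType) (z : R[i]) : R[i] := ln (normc z) +i* carg z.

Definition cpowm (R : realType) (m : nat) (z : R[i]) (M : 'M[R[i]]_m.+1) :
  'M[R[i]]_m.+1 := expm (clog z *: M).

Definition piecewiseC1 (R : realType) (f : R -> R) : Prop :=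
  continuous f /\
  exists s : seq R,
    (forall t, t \notin s -> derivable f t 1 /\ {for t, continuous (derive1 f)}) /\
    (forall t, t \in s ->
       cvg (derive1 f @ t^'-) /\ cvg (derive1 f @ t^'+)).

Definition dpath (R : realType) (p : R -> R[i]) (t : R) : R[i] :=
  derive1 (Re \o p) t +i* derive1 (Im \o p) t.

(* A contour is parametrized by the whole real line; integrals along it are
   Lebesgue integrals of the real and imaginary parts, entry by entry.
   path_integral is a total operator (Rintegral); path_integrable says that
   the improper integral along the contour converges absolutely. *)
Definition path_integrand (R : realType) (m n : nat) (p : R -> R[i])
    (F : R[i] -> 'M[R[i]]_(m, n)) (i : 'I_m) (j : 'I_n) (t : R) : R[i] :=
  F (p t) i j * dpath p t.

Definition path_integrable (R : realType) (m n : nat) (p : R -> R[i])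
    (F : R[i] -> 'M[R[i]]_(m, n)) : Prop :=
  forall i j,
    mu.-integrable setT (fun t : R => (Re (path_integrand p F i j t))%:E) /\
    mu.-integrable setT (fun t : R => (Im (path_integrand p F i j t))%:E).

Definition path_integral (R : realType) (m n : nat) (p : R -> R[i])
    (F : R[i] -> 'M[R[i]]_(m, n)) : 'M[R[i]]_(m, n) :=
  \matrix_(i, j)
    ((\int[mu]_(t in [set: R]) Re (path_integrand p F i j t))
     +i* (\int[mu]_(t in [set: R]) Im (path_integrand p F i j t))).

(* From -oo below the cut ]-oo, 0] to -oo above it without meeting the cut:
   such a curve turns once, counterclockwise, around the origin. *)
Definition hankel_contour (R : realType) (g : R -> R[i]) : Prop :=
  [/\ piecewiseC1 (Re \o g) /\ piecewiseC1 (Im \o g),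
      (forall t, Im (g t) = 0 -> 0 < Re (g t)),
      (Re (g t) @[t --> -oo] --> -oo) /\
        (\forall t \near -oo, Im (g t) < 0) &
      (Re (g t) @[t --> +oo] --> -oo) /\
        (\forall t \near +oo, 0 < Im (g t))].

Definition vert_line (R : realType) (L t : R) : R[i] := L +i* t.

Definition Amx (R : realType) (m : nat) (nu : 'I_m -> R) : 'M[R]_m.+1 :=
  \sum_(i < m) nu i *: delta_mx (widen_ord (leqnSn m) i) (lift ord0 i).

Definition Jmx (R : realType) (m : nat) : 'M[R[i]]_m.+1 :=
  \sum_(i < m.+1) (m - i)%N%:R *: delta_mx i i.

Definition hermite_weight (R : realType) (m : nat) (A : 'M[R]_m.+1) (x : R) :
  'M[R]_m.+1 := expR (- x ^+ 2) *: (expm (x *: A) *m expm (x *: A^T)).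

Definition mxinner (R : realType) (m : nat) (W F G : R -> 'M[R]_m.+1) :
  'M[R]_m.+1 :=
  \matrix_(i, j) \int[mu]_(x in [set: R]) (F x *m W x *m (G x)^T) i j.

Definition mxpoly_fun (R : realType) (m : nat) (p : {poly 'M[R]_m.+1}) (x : R) :
  'M[R]_m.+1 := p.[x%:M].

Definition monic_mops (R : realType) (m : nat) (W : R -> 'M[R]_m.+1)
    (Phat : nat -> {poly 'M[R]_m.+1}) : Prop :=
  (forall k, size (Phat k) = k.+1 /\ Phat k \is monic) /\
  (forall k l, k <> l ->
     mxinner W (mxpoly_fun (Phat k)) (mxpoly_fun (Phat l)) = 0).

Definition expm_normalize (R : realType) (m : nat) (A : 'M[R]_m.+1)
    (Phat : nat -> {poly 'M[R]_m.+1}) (k : nat) (x : R) : 'M[R]_m.+1 :=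
  expm (- (4%:R^-1 *: A ^+ 2)) *m mxpoly_fun (Phat k) x.

Definition posdefmx (R : realType) (m : nat) (M : 'M[R]_m) : Prop :=
  M^T = M /\ forall v : 'rV[R]_m, v != 0 -> 0 < (v *m M *m v^T) 0 0.

(* the positive definite square root, when M is positive definite *)
Definition sqrtmx (R : realType) (m : nat) (M : 'M[R]_m) : 'M[R]_m :=
  xget 0 [set S : 'M[R]_m | posdefmx S /\ S *m S = M].

Definition normsq (R : realType) (m : nat) (W F : R -> 'M[R]_m.+1) :
  'M[R]_m.+1 := mxinner W F F.

Definition Phi (R : realType) (m : nat) (A : 'M[R]_m.+1)
    (P : nat -> R -> 'M[R]_m.+1) (k : nat) (x : R) : 'M[R]_m.+1 :=
  expR (- (x ^+ 2 / 2)) *: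
    (sqrtmx (invmx (normsq (hermite_weight A) (P k))) *m P k x *m expm (x *: A)).

Definition CDkernel (R : realType) (m : nat) (A : 'M[R]_m.+1)
    (P : nat -> R -> 'M[R]_m.+1) (n : nat) (x y : R) : 'M[R]_m.+1 :=
  \sum_(k < n) (Phi A P k y)^T *m Phi A P k x.

Definition Mker (R : realType) (m : nat) (A : 'M[R]_m.+1)
    (P : nat -> R -> 'M[R]_m.+1) (C D : nat -> 'M[R[i]]_m.+1) (n : nat)
    (z w : R[i]) : 'M[R[i]]_m.+1 :=
  let J := Jmx R m in
  cpowm z J *m
    (z^-1 *: \sum_(k < n) ((w / z) ^+ k *:
       ((C k)^T *m cpowm z (- J)
        *m toC (invmx (normsq (hermite_weight A) (P k)))
        *m cpowm w J *m D k)))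
    *m cpowm w (- J).

(* Main.v *)
(* For z and w fixed, the double integrand is the finite sum over k < n of
   F_k(z)^T ||P_k||^-2 G_k(w), where F_k and G_k are the integrands of the two
   representations of P_k e^{Ax}; transposing z^{-J} C_k z^J puts the powers of
   z on the required sides because J is diagonal.  Integrating term by term
   gives the sum of (P_k(y) e^{Ay})^T ||P_k||^-2 P_k(x) e^{Ax}, up to the
   Gaussian prefactor.
   This is the kernel as soon as ||P_k||^-1 is a genuine square root, that is,
   as soon as ||P_k||^2 is positive definite.  Since A is nilpotent,
   P_k(x) e^{Ax} is a matrix polynomial q, so the entries of ||P_k||^2 are
   convergent Gaussian moments of q q^T, and v q = 0 forces v = 0 because the
   exponentials are invertible and P_k^ is monic. *)

Require Import Defs.
From HB Require Import structures.
From mathcomp Require Import all_boot all_order all_algebra.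
From mathcomp Require Import all_classical all_reals all_analysis.
From mathcomp Require Import complex.
From mathcomp Require Import polyrcf measurable_realfun ring lra.

Set Implicit Arguments.
Unset Strict Implicit.
Unset Printing Implicit Defensive.
Import Order.TTheory GRing.Theory Num.Theory.
Import numFieldNormedType.Exports.
Local Open Scope classical_set_scope.
Local Open Scope ring_scope.
Local Open Scope complex_scope.

(** * Transposition and exponentials of nilpotent matrices *)

Lemma trmx_continuous (K : numFieldType) (m n : nat) :
  continuous (@trmx K m.+1 n.+1).
Proof.
move=> M P [/= f fM fP]; exists (fun i j => f j i) => [i j|N fN].
  by have := fM j i; rewrite mxE.
by apply: fP => i j; rewrite mxE; exact: fN.
Qed.

Lemma trmx_exp (R : comPzRingType) (m k : nat) (M : 'M[R]_m.+1) :
  (M ^+ k)^T = M^T ^+ k.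
Proof.
elim: k => [|k IHk]; first by rewrite !expr0 trmx1.
by rewrite exprS exprSr -IHk trmx_mul.
Qed.

(** Transposition is continuous and commutes with the partial sums. *)
Lemma expm_tr (K : numFieldType) (m : nat) (M : 'M[K]_m.+1) :
  expm M^T = (expm M)^T.
Proof.
rewrite /expm; set f := series _; set g := series _.
have fg k : f k = (g k)^T.
  rewrite /f /g /series /= linear_sum; apply: eq_bigr => i _ /=.
  by rewrite linearZ /= trmx_exp.
have gf k : g k = (f k)^T by rewrite fg trmxK.
have [cg|dg] := pselect (cvg (g @ \oo)).
  apply: (cvg_lim (@norm_hausdorff K 'M[K]_m.+1)).
  rewrite (_ : f = trmx \o g); last exact/funext.
  by apply: cvg_comp cg _; exact: trmx_continuous.
(* In the divergent case both limits are the default matrix, whose entries are all equal and which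
   is its own transpose. *)
rewrite (dvgP dg) dvgP.
  by apply/matrixP => i j; rewrite !mxE.
apply: contra_not dg => cf; apply/cvg_ex; exists (lim (f @ \oo))^T.
rewrite (_ : g = trmx \o f); last exact/funext.
by apply: cvg_comp cf _; exact: trmx_continuous.
Qed.

Lemma expm_nilpotent (K : numFieldType) (m n : nat) (M : 'M[K]_m.+1) :
  M ^+ n = 0 -> expm M = \sum_(k < n) (k`!%:R)^-1 *: M ^+ k.
Proof.
move=> Mn; apply/cvg_lim; first exact: (@norm_hausdorff K 'M[K]_m.+1).
apply: (@cvg_near_cst _ _ _ _ _ _); near=> N.
rewrite /series /= (big_cat_nat (n := n)) //=; last by near: N; exact: nbhs_infty_ge.
rewrite big_mkord [X in _ + X]big1_seq ?addr0 // => i.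
rewrite mem_index_iota => /andP[_ /andP[ni _]].
by rewrite -(subnK ni) exprD Mn mulr0 scaler0.
Unshelve. all: by end_near. Qed.

(** The exponential is 1 + M Y with Y commuting with M, so M Y is nilpotent and a geometric sum in -
    M Y gives the inverse. *)
Lemma expm_nilpotent_unit (K : numFieldType) (m n : nat) (M : 'M[K]_m.+1) :
  M ^+ n = 0 -> expm M \in unitmx.
Proof.
move=> Mn.
(* The bound [n.+1] guarantees a constant term to split off, also for n = 0. *)
have -> : expm M = \sum_(k < n.+1) (k`!%:R)^-1 *: M ^+ k.
  by apply: expm_nilpotent; rewrite exprS Mn mulr0.
rewrite big_ord_recl /= fact0 invr1 scale1r expr0.
pose Y := \sum_(k < n) ((k.+1)`!%:R)^-1 *: M ^+ k.
have -> : \sum_(k < n) ((lift ord0 k)`!%:R)^-1 *: M ^+ lift ord0 k = M * Y.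
  by rewrite mulr_sumr; apply: eq_bigr => k _; rewrite -scalerAr -exprS.
have MY : GRing.comm M Y.
  by apply: commr_sum => i _; rewrite /GRing.comm -scalerAr -scalerAl -exprS exprSr.
have XN : (- (M * Y)) ^+ n = 0 by rewrite exprNn exprMn_comm // Mn mul0r mulr0.
have := subrX1 (- (M * Y)) n; rewrite XN sub0r -opprD mulNr => /oppr_inj.
by rewrite addrC => /esym /mulmx1_unit [].
Qed.

(** * Square roots of positive definite matrices *)

Lemma poly_interpolation (K : fieldType) (s : seq K) (f : K -> K) :
  exists p : {poly K}, forall a, a \in s -> p.[a] = f a.
Proof.
elim: s => [|b s [p ps]]; first by exists 0.
have [bs|bs] := boolP (b \in s).
  by exists p => a; rewrite inE => /predU1P[->|]; exact: ps.
(* Newton's correction: [q] vanishes at the nodes already treated and not at [b]. *)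
pose q := \prod_(c <- s) ('X - c%:P).
have qb : q.[b] != 0 by rewrite -/(root q b) root_prod_XsubC.
exists (p + ((f b - p.[b]) / q.[b]) *: q) => a; rewrite !hornerE inE.
have [->|ab /= as_] := eqVneq a b; first by rewrite divfK // addrC subrK.
have /rootP -> : root q a by rewrite root_prod_XsubC.
by rewrite mulr0 addr0 ps.
Qed.

Lemma row_mul_tr_gt0 (K : realDomainType) (n : nat) (v : 'rV[K]_n) :
  v != 0 -> 0 < (v *m v^T) 0 0.
Proof.
move=> /rV0Pn[j vj]; rewrite mxE.
have vv_ge0 i : 0 <= v 0 i * v^T i 0 by rewrite mxE -expr2 sqr_ge0.
rewrite lt_def sumr_ge0 ?andbT // psumr_neq0 //; apply/hasP; exists j.
  exact: mem_index_enum.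
by rewrite lt_def vv_ge0 mxE mulf_neq0.
Qed.

(** Over [R[i]] the matrix is Hermitian, hence unitarily diagonalizable with real eigenvalues, and
    polynomials in it are evaluated on the diagonal. This reduces polynomial identities in M to
    identities on its spectrum. *)
Lemma symmetric_annihilator (R : realType) (m : nat) (M : 'M[R]_m.+1) :
  M^T = M ->
  exists2 s : seq R, (forall a, a \in s -> eigenvalue M a) &
    forall q : {poly R}, (forall a, a \in s -> q.[a] = 0) -> horner_mx M q = 0.
Proof.
move=> Msym; pose Mc := map_mx (real_complex R) M.
have Mherm : Mc \is hermsymmx.
  apply: realsym_hermsym.
    apply/is_hermitianmxP/matrixP => i j.
    by rewrite expr0 scale1r !mxE -{1}Msym mxE.
  by apply/mxOverP => i j; rewrite mxE; apply/complex_realP; exists (M i j).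
have /orthomx_spectralP := hermitian_normalmx Mherm.
have := hermitian_spectral_diag_real Mherm.
have := spectral_unit Mc.
set U := spectralmx Mc; set d := spectral_diag Mc => Uu dr Md.
pose a := map_mx (@complex.Re R) d.
have da : d = map_mx (real_complex R) a.
  by apply/matrixP => i j; rewrite !mxE RRe_real //; exact: mxOverP.
exists [seq a 0 j | j : 'I_m.+1] => [_ /mapP[j _ ->]|q q0].
  (* The characteristic polynomial carries the question over to [Mc], where row j of the invertible
     [U] is an eigenvector. *)
  rewrite eigenvalue_root_char -(fmorph_root (real_complex R)).
  rewrite [X in root X]map_char_poly -/Mc -eigenvalue_root_char.
  apply/eigenvalueP; exists (row j U).
    rewrite Md !mulmxA -row_mul mulmxV // row1 -rowE row_diag_mx -scalemxAl -rowE.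
    by rewrite da !mxE.
  apply/eqP => Uj0; have := Uu; rewrite -row_free_unit => /row_freeP[V UV].
  have := congr1 (row j) UV; rewrite row_mul Uj0 mul0mx => /rowP /(_ j).
  by rewrite !mxE eqxx => /esym/eqP; rewrite oner_eq0.
apply: (@map_mx_inj _ _ (real_complex R)); rewrite map_mx0 map_horner_mx -/Mc Md.
rewrite horner_mx_uconjC // horner_mx_diag da.
rewrite [X in diag_mx X](_ : _ = 0) ?linear0 ?mulmx0 ?mul0mx //.
apply/rowP => j; rewrite !mxE horner_map /= q0 //.
by apply/mapP; exists j; rewrite ?mem_enum ?mxE.
Qed.

(** A nonzero left kernel vector would make the quadratic form vanish; the form of the inverse at v
    is that of M at v M^-1. *)
Lemma posdefmx_invmx (R : realType) (m : nat) (M : 'M[R]_m.+1) :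
  posdefmx M -> M \in unitmx /\ posdefmx (invmx M).
Proof.
move=> [Msym Mpos].
have Mu : M \in unitmx.
  rewrite -row_free_unit; apply/inj_row_free => v vM; apply/eqP.
  by apply: contraT => /Mpos; rewrite vM mul0mx mxE ltxx.
split=> //; split=> [|v v0]; first by rewrite trmx_inv Msym.
have := Mpos (v *m invmx M); rewrite mulmxKV // trmx_mul trmx_inv Msym mulmxA.
by apply; apply: contra_neq v0 => /(congr1 (mulmx^~ M)); rewrite mulmxKV // mul0mx.
Qed.

(* The interpolating polynomial takes fourth roots rather than square roots:
   the square of a symmetric invertible matrix is positive definite. *)
Lemma posdefmx_sqrt (R : realType) (m : nat) (M : 'M[R]_m.+1) :
  posdefmx M -> exists S, posdefmx S /\ S *m S = M.
Proof.
move=> Mpd; have [Mu _] := posdefmx_invmx Mpd; case: Mpd => Msym Mpos.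
have [s sM s0] := symmetric_annihilator Msym.
have [p ps] := poly_interpolation s (fun a => Num.sqrt (Num.sqrt a)).
have a_ge0 a : a \in s -> 0 <= a.
  move=> /sM /eigenvalueP[v vM v0]; have := Mpos _ v0.
  by rewrite vM -scalemxAl mxE pmulr_lgt0 ?row_mul_tr_gt0 // => /ltW.
pose T := horner_mx M p.
have Tsym : T^T = T.
  rewrite /T -[p]coefK poly_def linear_sum /= linear_sum; apply: eq_bigr => i _ /=.
  by rewrite linearZ /= rmorphXn /= horner_mx_X linearZ /= trmx_exp Msym.
(* The polynomial p^4 - X vanishes on the spectrum, hence at M. *)
have T4 : T ^+ 4 = M.
  apply/eqP; rewrite -subr_eq0 -[X in _ - X](horner_mx_X M) -rmorphXn -rmorphB /=.
  apply/eqP/s0 => a /[dup] as_ /a_ge0 a0; rewrite !hornerE ps //.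
  by rewrite (exprM _ 2 2) !sqr_sqrtr ?sqrtr_ge0 // subrr.
have Tu : T \in unitmx.
  rewrite -[T \in _]/(T \is a GRing.unit) -(@unitrX_pos _ _ 4) // T4; exact: Mu.
exists (T ^+ 2); split; last by rewrite -[_ *m _]/(T ^+ 2 * T ^+ 2) -exprD.
split=> [|v v0]; first by rewrite trmx_exp Tsym.
rewrite expr2 -[T * T]/(T *m T) mulmxA -mulmxA -[X in _ *m (X *m _)]Tsym -trmx_mul.
apply: row_mul_tr_gt0; apply: contra_neq v0 => /(congr1 (mulmx^~ (invmx T))).
by rewrite mulmxK // mul0mx.
Qed.

(** [xget] falls back to 0 only on an empty set, which the existence of a root excludes. *)
Lemma sqrtmxP (R : realType) (m : nat) (M : 'M[R]_m.+1) :
  posdefmx M -> (sqrtmx M)^T = sqrtmx M /\ sqrtmx M *m sqrtmx M = M.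
Proof.
move=> /posdefmx_sqrt[S SM]; rewrite /sqrtmx.
by case: xgetP => [T _ [[Tsym _] TM]|/(_ S)] //.
Qed.

(** * Gaussian moments of polynomials *)

Local Notation mu := (@lebesgue_measure _).

Lemma expr_le_expR (R : realType) (n : nat) (x : R) :
  0 <= x -> x ^+ n <= n`!%:R * expR x.
Proof.
case: n => [|n] x0; first by rewrite expr0 fact0 mul1r -expR0 ler_expR.
rewrite mulrC -ler_pdivrMr ?ltr0n ?fact_gt0 //.
by apply: le_trans (expR_ge1Dxn n x0); rewrite lerDr.
Qed.

(** Bounding |x|^n by n! e^|x| and |x| by 1/2 + x^2/2 leaves half of the Gaussian exponent, that of
    the standard normal density. *)
Lemma gauss_Xn_le (R : realType) (n : nat) (x : R) :
  `|expR (- x ^+ 2) * x ^+ n| <=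
  n`!%:R * expR 2^-1 / normal_peak 1 * normal_pdf 0 1 x.
Proof.
rewrite normal_pdfE ?oner_neq0 // /normal_fun subr0 expr1n.
have pk : normal_peak 1 != 0 :> R by rewrite gt_eqF // normal_peak_gt0 ?oner_neq0.
rewrite mulrA divfK // normrM (ger0_norm (expR_ge0 _)) normrX.
apply: le_trans (ler_wpM2l (expR_ge0 _) (expr_le_expR n (normr_ge0 x))) _.
rewrite mulrCA -!mulrA ler_wpM2l // -!expRD ler_expR.
have := sqr_ge0 (`|x| - 1); rewrite -[x ^+ 2]real_normK ?num_real //.
by set y := `|x|; nra.
Qed.

Lemma integrable_gauss_Xn (R : realType) (n : nat) :
  mu.-integrable [set: R] (fun x => (expR (- x ^+ 2) * x ^+ n)%:E).
Proof.
have := integrableZl measurableT (n`!%:R * expR 2^-1 / normal_peak 1)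
  (integrable_normal_pdf (0 : R) 1).
apply: le_integrable => // [|x _].
  apply/measurable_EFinP; apply: measurable_funM; first exact: measurable_gauss_fun.
  exact: measurable_funX.
rewrite -EFinM lee_fin; apply: le_trans (gauss_Xn_le n x) _; exact: ler_norm.
Qed.

Definition gauss_poly (R : realType) (p : {poly R}) (x : R) :=
  expR (- x ^+ 2) * p.[x].

Lemma integrable_gauss_poly (R : realType) (p : {poly R}) :
  mu.-integrable [set: R] (EFin \o gauss_poly p).
Proof.
rewrite (_ : EFin \o _ = fun x =>
    (\sum_(i < size p) (p`_i)%:E * (expR (- x ^+ 2) * x ^+ i)%:E)%E).
  apply: integrable_sum => // i _; apply: integrableZl => //.
  exact: integrable_gauss_Xn.
apply/funext => x; rewrite /gauss_poly /= horner_coef mulr_sumr -sumEFin.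
by apply: eq_bigr => i _; rewrite -EFinM mulrCA.
Qed.

(** Seen as a linear functional on polynomials, it applies entrywise to polynomial matrices and
    commutes with constant coefficients. *)
Definition gauss_moment (R : realType) (p : {poly R}) : R :=
  \int[mu]_(x in [set: R]) gauss_poly p x.

Lemma gauss_moment_scalar (R : realType) : scalar (@gauss_moment R).
Proof.
move=> a p q; rewrite /gauss_moment.
rewrite -RintegralZl //; last exact: integrable_gauss_poly.
have iap := integrableZl measurableT a (integrable_gauss_poly p).
rewrite -(RintegralD measurableT iap (integrable_gauss_poly q)).
apply: eq_Rintegral => x _; rewrite /gauss_poly hornerD hornerZ mulrDr.
by congr (_ + _); rewrite mulrCA.
Qed.

HB.instance Definition _ (R : realType) :=
  GRing.isLinear.Build R {poly R} R *%R (@gauss_moment R)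
    (@gauss_moment_scalar R).

(** A nonzero polynomial has finitely many roots, and a finite set together with a null set cannot
    cover the line, whose measure is at least that of [0, 1]. *)
Lemma ae0_horner_eq0 (R : realType) (p : {poly R}) :
  {ae mu, forall x : R, p.[x] = 0} -> p = 0.
Proof.
move=> [N [mN N0 pN]]; apply/eqP; apply: contraT => p0.
pose Z := [set x : R | x \in rootsR p].
have Z0 : mu Z = 0.
  apply: countable_lebesgue_measure0; apply: finite_set_countable.
  exact: finite_seq.
have mZ : measurable Z.
  apply: countable_measurable => [t|]; first exact: measurable_set1.
  by apply: finite_set_countable; exact: finite_seq.
have : (mu [set: R] <= mu (N `|` Z))%E.
  apply: le_measure; rewrite ?inE //; first exact: measurableU.
  move=> x _; have [px|px] := eqVneq p.[x] 0.
    by right; rewrite /Z /= -roots_on_rootsR // inE /root px eqxx.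
  by left; apply: pN => /= /eqP; rewrite (negbTE px).
rewrite leNgt => /negP[]; rewrite (measureU0 mN mZ Z0) [X in (X < _)%E]N0.
have : (1%E <= mu [set: R])%E.
  rewrite (_ : 1%E = mu (`[0, 1]%classic : set R)).
    by apply: le_measure; rewrite ?inE.
  by rewrite lebesgue_measure_itv /= lte_fin ltr01 oppr0 adde0.
by apply: lt_le_trans; rewrite lte_fin.
Qed.

(** If the nonnegative integrand had integral zero, it would vanish almost everywhere, and so would
    the polynomial, the Gaussian being positive. *)
Lemma gauss_moment_gt0 (R : realType) (p : {poly R}) :
  p != 0 -> (forall x, 0 <= p.[x]) -> 0 < gauss_moment p.
Proof.
move=> p0 p_ge0.
have gp_ge0 x : 0 <= gauss_poly p x by rewrite mulr_ge0 ?expR_ge0.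
rewrite lt_def Rintegral_ge0 ?andbT //; apply: contra_neq p0 => Ip0.
apply: ae0_horner_eq0.
have := integrable_gauss_poly p => /[dup] ip /integrableP[mp _].
have : (\int[mu]_x `|(EFin \o gauss_poly p) x| = 0)%E.
  rewrite -[RHS]/(0%:E) -Ip0 /gauss_moment /Rintegral fineK.
    by apply: eq_integral => x _; rewrite gee0_abs // lee_fin.
  exact: integrable_fin_num.
move/(ae_eq_integral_abs mu measurableT mp); apply: filterS => x /= /(_ I) [].
by move/eqP; rewrite mulf_eq0 gt_eqF ?expR_gt0 //= => /eqP.
Qed.

(** * Positive definiteness of the squared norms *)

Lemma strictly_upper_exp (R : pzRingType) (m k : nat) (M : 'M[R]_m.+1) :
  (forall i j : 'I_m.+1, (j <= i)%N -> M i j = 0) ->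
  forall i j : 'I_m.+1, (j < i + k)%N -> (M ^+ k) i j = 0.
Proof.
move=> M0; elim: k => [|k IHk] i j ij.
  by rewrite expr0 mxE; case: eqP ij => // ->; rewrite addn0 ltnn.
rewrite exprS mxE big1 // => l _.
(* Either l <= i and the first factor is zero, or i < l and the induction hypothesis applies in row
   l. *)
have [li|il] := leqP l i; first by rewrite M0 ?mul0r.
by rewrite IHk ?mulr0 // (leq_trans ij) // addnS -addSn leq_add2r.
Qed.

Lemma Amx_nilpotent (R : realType) (m : nat) (nu : 'I_m -> R) :
  Amx nu ^+ m.+1 = 0.
Proof.
(* Column indices are at most m, so the exponent m + 1 reaches every entry. *)
apply/matrixP => i j; rewrite mxE strictly_upper_exp //; last first.
  by rewrite ltn_addl.
move=> {}i {}j ji; rewrite summxE big1 // => l _; rewrite !mxE.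
case: eqP => [il|]; last by rewrite mulr0.
case: eqP => [jl|]; last by rewrite mulr0.
by move: ji; rewrite il jl /= /bump /= ltnn.
Qed.

Lemma mxpoly_funE (R : realType) (m : nat) (p : {poly 'M[R]_m.+1}) (x : R) :
  mxpoly_fun p x = \sum_(i < size p) x ^+ i *: p`_i.
Proof.
rewrite /mxpoly_fun horner_coef; apply: eq_bigr => i _.
by rewrite -rmorphXn -mul_mx_scalar.
Qed.

(** A matrix of polynomials instead of a polynomial with matrix coefficients: evaluation is then an
    entrywise ring morphism, compatible with products and transposes. *)
Definition polynomial_mx (R : realType) (m n : nat) (F : R -> 'M[R]_(m, n)) :=
  exists q : 'M[{poly R}]_(m, n), forall x, F x = map_mx (horner_eval x) q.

Lemma polynomial_mx_sum (R : realType) (m n k : nat) (B : 'I_k -> 'M[R]_(m, n)) :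
  polynomial_mx (fun x => \sum_(i < k) x ^+ i *: B i).
Proof.
exists (\sum_(i < k) 'X^i *: map_mx polyC (B i)) => x.
rewrite raddf_sum; apply: eq_bigr => i _; apply/matrixP => r c.
by rewrite !mxE /= horner_evalE hornerM hornerXn hornerC.
Qed.

Lemma polynomial_mx_mxpoly (R : realType) (m : nat) (p : {poly 'M[R]_m.+1}) :
  polynomial_mx (mxpoly_fun p).
Proof.
have [q pq] := polynomial_mx_sum (fun i : 'I_(size p) => p`_i).
by exists q => x; rewrite -pq mxpoly_funE.
Qed.

Lemma polynomial_mx_expm (R : realType) (m n : nat) (A : 'M[R]_m.+1) :
  A ^+ n = 0 -> polynomial_mx (fun x => expm (x *: A)).
Proof.
move=> An.
have [q Aq] := polynomial_mx_sum (fun i : 'I_n => (i`!%:R)^-1 *: A ^+ i).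
exists q => x; rewrite -Aq (@expm_nilpotent _ _ n); last first.
  by rewrite exprZn An scaler0.
by apply: eq_bigr => i _; rewrite exprZn !scalerA mulrC.
Qed.

(** F W F^T is the Gaussian times (F e^(Ax)) (F e^(Ax))^T, because the second exponential in the
    weight is the transpose of the first. *)
Lemma normsq_gauss_moment (R : realType) (m : nat) (A : 'M[R]_m.+1)
    (F : R -> 'M[R]_m.+1) (q : 'M[{poly R}]_m.+1) :
  (forall x, F x *m expm (x *: A) = map_mx (horner_eval x) q) ->
  normsq (hermite_weight A) F = map_mx (@gauss_moment R) (q *m q^T).
Proof.
move=> Fq; apply/matrixP => i j; rewrite /normsq /mxinner !mxE.
apply: eq_Rintegral => x _; rewrite /hermite_weight /gauss_poly.
have -> : x *: A^T = (x *: A)^T by rewrite linearZ.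
rewrite expm_tr -scalemxAr -scalemxAl mxE; congr (_ * _).
rewrite -!mulmxA -trmx_mul mulmxA Fq map_trmx -map_mxM [LHS]mxE.
by rewrite /horner_eval [in LHS]mxE.
Qed.

(** With r = v q, the quadratic form at v is the moment of r r^T, a sum of squares of polynomials;
    it is zero only if r = 0. *)
Lemma gauss_moment_posdef (R : realType) (m : nat) (q : 'M[{poly R}]_m) :
  (forall v : 'rV[R]_m, (forall x, v *m map_mx (horner_eval x) q = 0) -> v = 0) ->
  posdefmx (map_mx (@gauss_moment R) (q *m q^T)).
Proof.
move=> q_inj; split=> [|v v0]; first by rewrite map_trmx trmx_mul trmxK.
pose r := map_mx polyC v *m q.
have -> : (v *m map_mx (@gauss_moment R) (q *m q^T) *m v^T) 0 0 =
          gauss_moment ((r *m r^T) 0 0).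
  rewrite /r trmx_mul !mulmxA -(mulmxA _ q).
  rewrite !mxE raddf_sum; apply: eq_bigr => j _.
  rewrite [in LHS]mxE [in RHS]mxE mulr_suml [in RHS]mulr_suml raddf_sum.
  apply: eq_bigr => i _.
  rewrite ![map_mx _ _ _ _]mxE ![_^T _ _]mxE [map_mx _ _ _ _]mxE.
  by rewrite /= mulrAC [in RHS]mulrAC -polyCM mul_polyC linearZ.
have rE x : ((r *m r^T) 0 0).[x] = \sum_j (r 0 j).[x] ^+ 2.
  by rewrite mxE horner_sum; apply: eq_bigr => j _; rewrite !mxE hornerM expr2.
apply: gauss_moment_gt0 => [|x]; last first.
  by rewrite rE sumr_ge0 // => j _; exact: sqr_ge0.
apply: contra_neq v0 => r0; apply: q_inj => x.
have -> : v *m map_mx (horner_eval x) q = map_mx (horner_eval x) r.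
  rewrite map_mxM; congr (_ *m _); apply/matrixP => i j.
  by rewrite !mxE /= horner_evalE hornerC.
apply/rowP => j; rewrite [LHS]mxE [RHS]mxE; apply/eqP; rewrite -sqrf_eq0; apply/eqP.
move: (rE x); rewrite r0 horner0 => /esym/eqP; rewrite psumr_eq0; last first.
  by move=> i _; exact: sqr_ge0.
by move=> /allP /(_ j (mem_index_enum _)) /implyP /(_ isT) /eqP.
Qed.

(** Each entry of u p(x) is a scalar polynomial vanishing identically, and its coefficient in the
    degree of p is the corresponding entry of u. *)
Lemma monic_mxpoly_inj (R : realType) (m : nat) (p : {poly 'M[R]_m.+1})
    (u : 'rV[R]_m.+1) :
  p \is monic -> (forall x, u *m mxpoly_fun p x = 0) -> u = 0.
Proof.
move=> /monicP p1 up0; apply/rowP => j.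
pose r := \poly_(i < size p) (u *m p`_i) 0 j.
have r0 : r = 0.
  apply: ae0_horner_eq0; apply: aeW => x; rewrite horner_poly.
  have := congr1 (fun M : 'rV__ => M 0 j) (up0 x).
  rewrite mxpoly_funE mulmx_sumr summxE mxE => {2}<-; apply: eq_bigr => i _.
  by rewrite -scalemxAr [RHS]mxE mulrC.
have := coef_poly (size p) (fun i => (u *m p`_i) 0 j) (size p).-1.
rewrite -/r r0 coef0 prednK ?leqnn; last first.
  by rewrite size_poly_gt0 -lead_coef_eq0 p1 oner_neq0.
by rewrite -/(lead_coef p) p1 [u *m 1]mulmx1 => <-; rewrite mxE.
Qed.

Lemma normsq_posdef (R : realType) (m n : nat) (A : 'M[R]_m.+1)
    (Phat : nat -> {poly 'M[R]_m.+1}) (k : nat) :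
  A ^+ n = 0 -> Phat k \is monic ->
  posdefmx (normsq (hermite_weight A) (expm_normalize A Phat k)).
Proof.
move=> An Pk.
have [p Pp] := polynomial_mx_mxpoly (Phat k).
have [e Ae] := polynomial_mx_expm An.
pose q := map_mx polyC (expm (- (4%:R^-1 *: A ^+ 2))) *m p *m e.
have qE x : expm_normalize A Phat k x *m expm (x *: A) = map_mx (horner_eval x) q.
  rewrite !map_mxM -Pp -Ae /expm_normalize; congr (_ *m _ *m _).
  by apply/matrixP => i j; rewrite !mxE /= horner_evalE hornerC.
rewrite (normsq_gauss_moment qE); apply: gauss_moment_posdef => v vq.
have Eu : expm (- (4%:R^-1 *: A ^+ 2)) \in unitmx.
  apply: (@expm_nilpotent_unit _ _ n).
  by rewrite -scaleNr exprZn exprAC An expr0n scaler0.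
rewrite -[v](mulmxK Eu); set u := v *m _.
suff -> : u = 0 by rewrite mul0mx.
apply: (monic_mxpoly_inj Pk) => x.
have xAu : expm (x *: A) \in unitmx.
  by apply: (@expm_nilpotent_unit _ _ n); rewrite exprZn An scaler0.
have := congr1 (mulmx^~ (invmx (expm (x *: A)))) (vq x).
by rewrite -qE /expm_normalize !mulmxA mulmxK // mul0mx.
Qed.

(** * Linearity of integrals along a contour *)

Definition cintegrable (R : realType) (f : R -> R[i]) : Prop :=
  mu.-integrable setT (fun t : R => (complex.Re (f t))%:E) /\
  mu.-integrable setT (fun t : R => (complex.Im (f t))%:E).

(** Each entry of [path_integral] unfolds to such an integral of a [path_integrand], so linearity
    can be settled for scalar functions. *)
Definition cintegral (R : realType) (f : R -> R[i]) : R[i] :=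
  (\int[mu]_(t in [set: R]) complex.Re (f t))
  +i* (\int[mu]_(t in [set: R]) complex.Im (f t)).

Lemma cintegral0 (R : realType) :
  cintegrable (fun _ : R => 0) /\ cintegral (fun _ : R => 0) = 0.
Proof.
split; first by split; exact: integrable0.
rewrite /cintegral /=; apply/eqP; rewrite eq_complex /=.
by rewrite /Rintegral integral0 /= eqxx.
Qed.

(** Integrability is returned with the value, since the next linearity rule to be applied requires
    it. *)
Lemma cintegralD (R : realType) (f g : R -> R[i]) :
  cintegrable f -> cintegrable g ->
  cintegrable (fun t => f t + g t) /\
  cintegral (fun t => f t + g t) = cintegral f + cintegral g.
Proof.
move=> [fr fi] [gr gi].
have ReD t : complex.Re (f t + g t) = complex.Re (f t) + complex.Re (g t).
  by case: (f t) (g t) => [? ?] [].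
have ImD t : complex.Im (f t + g t) = complex.Im (f t) + complex.Im (g t).
  by case: (f t) (g t) => [? ?] [].
rewrite /cintegrable /cintegral; under eq_fun do rewrite ReD.
under [X in _ /\ mu.-integrable _ X]eq_fun do rewrite ImD.
under [X in complex.Complex X _]eq_Rintegral do rewrite ReD.
under [X in complex.Complex _ X]eq_Rintegral do rewrite ImD.
split; first by split; [exact: (integrableD measurableT fr gr)|
                        exact: (integrableD measurableT fi gi)].
rewrite (RintegralD measurableT fr gr) (RintegralD measurableT fi gi).
by apply/eqP; rewrite eq_complex /= !eqxx.
Qed.

Lemma cintegralZ (R : realType) (a : R[i]) (f : R -> R[i]) :
  cintegrable f ->
  cintegrable (fun t => a * f t) /\
  cintegral (fun t => a * f t) = a * cintegral f.
Proof.
case: a => [b c] [fr fi].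
have ReM t : complex.Re ((b +i* c) * f t) =
    b * complex.Re (f t) - c * complex.Im (f t) by case: (f t).
have ImM t : complex.Im ((b +i* c) * f t) =
    b * complex.Im (f t) + c * complex.Re (f t) by case: (f t).
have br := integrableZl measurableT b fr; have cr := integrableZl measurableT c fr.
have bi := integrableZl measurableT b fi; have ci := integrableZl measurableT c fi.
rewrite /cintegrable /cintegral; under eq_fun do rewrite ReM.
under [X in _ /\ mu.-integrable _ X]eq_fun do rewrite ImM.
under [X in complex.Complex X _]eq_Rintegral do rewrite ReM.
under [X in complex.Complex _ X]eq_Rintegral do rewrite ImM.
split; first by split; [exact: (integrableB measurableT br ci)|
                        exact: (integrableD measurableT bi cr)].
rewrite (RintegralB measurableT br ci) (RintegralD measurableT bi cr).
by rewrite !RintegralZl //; apply/eqP; rewrite eq_complex /= !eqxx.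
Qed.

Lemma cintegral_sum (R : realType) (I : Type) (s : seq I) (f : I -> R -> R[i]) :
  (forall i, cintegrable (f i)) ->
  cintegrable (fun t => \sum_(i <- s) f i t) /\
  cintegral (fun t => \sum_(i <- s) f i t) = \sum_(i <- s) cintegral (f i).
Proof.
move=> fi; elim: s => [|i s [si sE]].
  rewrite (_ : (fun t => _) = fun=> 0) ?big_nil; last first.
    by apply/funext => t; rewrite big_nil.
  exact: cintegral0.
rewrite (_ : (fun t => _) = fun t => f i t + \sum_(j <- s) f j t); last first.
  by apply/funext => t; rewrite big_cons.
by rewrite big_cons -sE; exact: cintegralD.
Qed.

Lemma path_integral_tr (R : realType) (p : R -> R[i]) (m n : nat)
    (F : R[i] -> 'M[R[i]]_(m, n)) :
  path_integrable p F ->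
  path_integrable p (fun z => (F z)^T) /\
  path_integral p (fun z => (F z)^T) = (path_integral p F)^T.
Proof.
move=> Fi.
have Ft i j : path_integrand p (fun z => (F z)^T) i j = path_integrand p F j i.
  by apply/funext => t; rewrite /path_integrand mxE.
split=> [i j|]; first by rewrite Ft; exact: Fi.
by apply/matrixP => i j; rewrite !mxE Ft.
Qed.

Lemma path_integral_mull (R : realType) (p : R -> R[i]) (m n k : nat)
    (B : 'M[R[i]]_(m, n))
    (F : R[i] -> 'M[R[i]]_(n, k)) :
  path_integrable p F ->
  path_integrable p (fun z => B *m F z) /\
  path_integral p (fun z => B *m F z) = B *m path_integral p F.
Proof.
move=> Fi.
have BF i j : path_integrand p (fun z => B *m F z) i j =
    fun t => \sum_l B i l * path_integrand p F l j t.
  apply/funext => t; rewrite /path_integrand mxE mulr_suml.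
  by apply: eq_bigr => l _; rewrite mulrA.
have BFi i j l : cintegrable (fun t => B i l * path_integrand p F l j t).
  by apply: (cintegralZ _ _).1; exact: Fi.
split=> [i j|]; first by rewrite BF; exact: (cintegral_sum _ (BFi i j)).1.
apply/matrixP => i j; rewrite !mxE BF.
rewrite -/(cintegral _) (cintegral_sum _ (BFi i j)).2; apply: eq_bigr => l _.
by rewrite (cintegralZ _ (Fi l j)).2 mxE.
Qed.

Lemma path_integral_mulr (R : realType) (p : R -> R[i]) (m n k : nat)
    (F : R[i] -> 'M[R[i]]_(m, n))
    (B : 'M[R[i]]_(n, k)) :
  path_integrable p F ->
  path_integrable p (fun z => F z *m B) /\
  path_integral p (fun z => F z *m B) = path_integral p F *m B.
Proof.
move=> Fi.
have -> : (fun z => F z *m B) = fun z => (B^T *m (F z)^T)^T.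
  by apply/funext => z; rewrite trmx_mul !trmxK.
have [Fti FtE] := path_integral_tr Fi.
have [BFi BFE] := path_integral_mull B^T Fti.
have [BFti ->] := path_integral_tr BFi.
by rewrite BFE FtE trmx_mul !trmxK.
Qed.

Lemma path_integral_sum (R : realType) (p : R -> R[i]) (m n : nat)
    (I : finType)
    (F : I -> R[i] -> 'M[R[i]]_(m, n)) :
  (forall k, path_integrable p (F k)) ->
  path_integrable p (fun z => \sum_k F k z) /\
  path_integral p (fun z => \sum_k F k z) = \sum_k path_integral p (F k).
Proof.
move=> Fi.
have SF i j : path_integrand p (fun z => \sum_k F k z) i j =
    fun t => \sum_k path_integrand p (F k) i j t.
  by apply/funext => t; rewrite /path_integrand summxE mulr_suml.
split=> [i j|]; first by rewrite SF; exact: (cintegral_sum _ (fun k => Fi k i j)).1.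
apply/matrixP => i j; rewrite summxE mxE SF.
rewrite -/(cintegral _) (cintegral_sum _ (fun k => Fi k i j)).2.
by apply: eq_bigr => k _; rewrite mxE.
Qed.

(** * Separation of variables in the integrand and the kernel *)

Lemma trmxZ (R : pzRingType) (m n : nat) (c : R) (M : 'M[R]_(m, n)) :
  (c *: M)^T = c *: M^T.
Proof. by apply/matrixP => i j; rewrite !mxE. Qed.

Lemma cexpD (R : realType) (a b : R[i]) : cexp (a + b) = cexp a * cexp b.
Proof.
case: a b => [ar ai] [br bi]; rewrite /cexp /= expRD cosD sinD.
by apply/eqP; rewrite eq_complex /=; apply/andP; split; apply/eqP; ring.
Qed.

Lemma Jmx_tr (R : realType) (m : nat) : (Jmx R m)^T = Jmx R m.
Proof.
rewrite /Jmx linear_sum; apply: eq_bigr => i _ /=.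
by rewrite linearZ /= trmx_delta.
Qed.

Lemma cpowm_tr (R : realType) (m : nat) (z : R[i]) (M : 'M[R[i]]_m.+1) :
  (cpowm z M)^T = cpowm z M^T.
Proof. by rewrite /cpowm -expm_tr linearZ. Qed.

(** Separates z from w by (w/z)^k / z = w^k / z^(k+1). Here X and X' stand for z^J and z^(-J), Y and
    Y' for w^J and w^(-J), a and b for the exponential factors. *)
Lemma sum_scalemx_split (K : fieldType) (m n : nat) (X X' Y Y' : 'M[K]_m)
    (B E Q : nat -> 'M[K]_m) (a b z w : K) :
  (a * b) *: (X *m (z^-1 *: \sum_(k < n) ((w / z) ^+ k *:
     ((B k)^T *m X' *m Q k *m Y *m E k))) *m Y') =
  \sum_(k < n) ((b / z ^+ k.+1) *: (X'^T *m B k *m X^T))^T *m Q k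
    *m ((a * w ^+ k) *: (Y *m E k *m Y')).
Proof.
rewrite scaler_sumr mulmx_sumr mulmx_suml scaler_sumr; apply: eq_bigr => k _.
rewrite trmxZ !trmx_mul !trmxK.
rewrite -!(scalemxAr, scalemxAl) !scalerA !mulmxA; congr (_ *: _).
by rewrite exprMn exprVn exprS invfM; ring.
Qed.

Lemma Mker_split (R : realType) (m : nat) (A : 'M[R]_m.+1)
    (P : nat -> R -> 'M[R]_m.+1) (C D : nat -> 'M[R[i]]_m.+1) (n : nat)
    (a b z w : R[i]) :
  let J := Jmx R m in
  cexp (a + b) *: Mker A P C D n z w =
  \sum_(k < n)
    ((cexp b / z ^+ k.+1) *: (cpowm z (- J) *m C k *m cpowm z J))^T
    *m toC (invmx (normsq (hermite_weight A) (P k)))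
    *m ((cexp a * w ^+ k) *: (cpowm w J *m D k *m cpowm w (- J))).
Proof.
move=> J; have zJ : cpowm z J = (cpowm z J)^T by rewrite cpowm_tr Jmx_tr.
have zNJ : cpowm z (- J) = (cpowm z (- J))^T.
  by rewrite cpowm_tr linearN /= Jmx_tr.
(* The powers of z on the right are transposed to match the abstract identity; they are symmetric
   because J is. *)
rewrite cexpD [in RHS]zJ [in RHS]zNJ.
exact: (sum_scalemx_split _ _ _ _ _ _ _
  (fun k => toC (invmx (normsq (hermite_weight A) (P k))))).
Qed.

(** The square root S of the inverse squared norm is symmetric, so each term contains S^T S = S^2,
    the inverse itself. *)
Lemma CDkernel_split (R : realType) (m : nat) (A : 'M[R]_m.+1)
    (P : nat -> R -> 'M[R]_m.+1) (n : nat) (x y : R) :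
  (forall k, posdefmx (normsq (hermite_weight A) (P k))) ->
  CDkernel A P n x y = expR (- ((x ^+ 2 + y ^+ 2) / 2)) *: \sum_(k < n)
    (P k y *m expm (y *: A))^T *m invmx (normsq (hermite_weight A) (P k))
    *m (P k x *m expm (x *: A)).
Proof.
move=> Ppd; rewrite /CDkernel scaler_sumr; apply: eq_bigr => k _.
have [_ /sqrtmxP[Ssym SS]] := posdefmx_invmx (Ppd k).
rewrite /Phi; move: Ssym SS; set S := sqrtmx _; set Q := invmx _ => Ssym SS.
rewrite trmxZ -scalemxAl -scalemxAr scalerA -expRD.
rewrite -[S *m P k y *m _]mulmxA trmx_mul Ssym -SS !mulmxA.
by congr (expR _ *: _); lra.
Qed.

Theorem corollary2p1 (R : realType) (m : nat) (nu : 'I_m -> R)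
    (Phat : nat -> {poly 'M[R]_m.+1})
    (gamma : R -> R[i]) (L : R) (C D : nat -> 'M[R[i]]_m.+1) :
  let A := Amx nu in
  let J := Jmx R m in
  let P := expm_normalize A Phat in
  monic_mops (hermite_weight A) Phat ->
  hankel_contour gamma ->
  0 < L ->
  (forall t, complex.Re (gamma t) < L) ->
  (forall (x : R) (k : nat),
     let F := fun z : R[i] =>
       (cexp (- z ^+ 2 + 2 * z * x%:C) / z ^+ k.+1) *:
         (cpowm z (- J) *m C k *m cpowm z J) in
     path_integrable gamma F /\
     toC (P k x *m expm (x *: A)) = path_integral gamma F) ->
  (forall (x : R) (k : nat),
     let G := fun w : R[i] =>
       (cexp (w ^+ 2 - 2 * x%:C * w) * w ^+ k) *:
         (cpowm w J *m D k *m cpowm w (- J)) in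
     path_integrable (vert_line L) G /\
     toC (P k x *m expm (x *: A)) =
       (expR (x ^+ 2))%:C *: path_integral (vert_line L) G) ->
  forall (n : nat) (x y : R),
    let H := fun w z : R[i] =>
      cexp (w ^+ 2 - 2 * x%:C * w - z ^+ 2 + 2 * z * y%:C) *:
        Mker A P C D n z w in
    [/\ (forall t, path_integrable gamma (H (vert_line L t))),
        path_integrable (vert_line L) (fun w => path_integral gamma (H w)) &
        toC (CDkernel A P n x y) =
          (expR ((x ^+ 2 - y ^+ 2) / 2))%:C *:
            path_integral (vert_line L) (fun w => path_integral gamma (H w))].
Proof.
move=> A J P [Pmonic _] _ _ _ PF PG n x y H.
pose Q k := toC (invmx (normsq (hermite_weight A) (P k))).
pose F k (z : R[i]) := (cexp (- z ^+ 2 + 2 * z * y%:C) / z ^+ k.+1) *: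
  (cpowm z (- J) *m C k *m cpowm z J).
pose G k (w : R[i]) := (cexp (w ^+ 2 - 2 * x%:C * w) * w ^+ k) *:
  (cpowm w J *m D k *m cpowm w (- J)).
have HE w : H w = fun z => \sum_(k < n) (F k z)^T *m Q k *m G k w.
  (* The exponent is regrouped into a part in w and a part in z. *)
  by apply/funext => z; rewrite /H -[_ - z ^+ 2 + _]addrA Mker_split.
(* For fixed w only F_k(z) varies; its integral is the representation at y. *)
have FQG w (k : 'I_n) : path_integrable gamma (fun z => (F k z)^T *m Q k *m G k w) /\
    path_integral gamma (fun z => (F k z)^T *m Q k *m G k w) =
    (path_integral gamma (F k))^T *m Q k *m G k w.
  have [Fi _] := PF y k; have [Fti FtE] := path_integral_tr Fi.
  have [FQi FQE] := path_integral_mulr (Q k) Fti.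
  by have [] := path_integral_mulr (G k w) FQi; rewrite FQE FtE.
have HI w : path_integral gamma (H w) =
    \sum_(k < n) (path_integral gamma (F k))^T *m Q k *m G k w.
  rewrite HE (path_integral_sum (fun k => (FQG w k).1)).2.
  by apply: eq_bigr => k _; rewrite (FQG w k).2.
(* The left factor is now constant in w, so the outer integral reduces to those of G_k, given by the
   representation at x. *)
have HIG (k : 'I_n) := path_integral_mull
  ((path_integral gamma (F k))^T *m Q k) (PG x k).1.
have [Hi HIE] := path_integral_sum (fun k => (HIG k).1).
rewrite (funext HI); split=> [t||].
- by rewrite HE; exact: (path_integral_sum (fun k => (FQG _ k).1)).1.
- exact: Hi.
rewrite [X in _ *: X]HIE CDkernel_split; last first.
  by move=> k; exact: normsq_posdef (Amx_nilpotent nu) (Pmonic k).2.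
rewrite /toC map_mxZ map_mx_sum [LHS]scaler_sumr [RHS]scaler_sumr.
apply: eq_bigr => k _.
have [_ yk] := PF y k; have [_ xk] := PG x k; rewrite (HIG k).2 -yk.
move: xk; move: (P k x *m _) (P k y *m _) => X Y xk.
rewrite !map_mxM -/(toC X) xk -[map_mx _ Y^T]map_trmx -scalemxAr scalerA -rmorphM.
(* The factor e^(x^2) of the representation on the vertical line turns -(x^2 + y^2)/2 into (x^2 -
   y^2)/2. *)
by rewrite -expRD; congr ((expR _)%:C *: _); lra.
Qed.
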